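(* The class of locally compact groups with Property FM satisfies the following. (1) If $G$ is a locally compact group and $H$ is an open subgroup of finite index in $G$, then $G$ has Property FM if and only if $H$ has Property FM. More generally, if $H$ is a closed cocompact subgroup of a locally compact group $G$ and $H$ has Property FM, then $G$ has Property FM. (2) If $G,H$ are locally compact groups, $f:G\to H$ is a continuous homomorphism with dense image, and $G$ has Property FM, then $H$ has Property FM; in particular, quotients of locally compact groups with Property FM have Property FM. (3) If $G$ is a locally compact group and $N$ is a closed normal subgroup such that both $N$ and $G/N$ have Property FM, then $G$ has Property FM. (4) If $G$ is a locally compact group with Property FM, then $G$ is compactly generated. In particular, if $G$ is discrete with Property FM, then it is finitely generated.
   Context: A continuous discrete $G$-set is a discrete set $X$ with a continuous action of the topological group $G$ (equivalently, all point stabilizers are open subgroups). A mean on $X$ is a finitely additive probability measure defined on all subsets of $X$. A locally compact group $G$ has Property FM if for every continuous discrete $G$-set $X$ admitting a $G$-invariant mean on all subsets of $X$, there exists a finite $G$-orbit in $X$. *)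

(* Defs.v *)
From HB Require Import structures.
From mathcomp Require Import all_boot all_order all_algebra.
From mathcomp Require Import all_classical all_reals.
From mathcomp Require Import topology.

Set Implicit Arguments.
Unset Strict Implicit.
Unset Printing Implicit Defensive.

Local Open Scope classical_set_scope.
Local Open Scope group_scope.

HB.mixin Record Group_isTopologicalGroup G & Topological G & Group G := {
  mulg_continuous : continuous (fun x : G * G => x.1 * x.2) ;
  invg_continuous : continuous (fun x : G => x^-1)
}.

#[short(type="topologicalGroupType")]
HB.structure Definition TopologicalGroup :=
  {G of Topological G & Group G & Group_isTopologicalGroup G}.

(* As usual for locally compact groups, the Hausdorff axiom is included. *)
Definition locally_compact_group (G : topologicalGroupType) : Prop :=
  hausdorff_space G /\ locally_compact [set: G].

Definition discrete_group (G : topologicalGroupType) : Prop :=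
  forall A : set G, open A.

Section subgroups.
Variable G : topologicalGroupType.

Definition is_subgroup (H : set G) : Prop :=
  H 1 /\ (forall x y, H x -> H y -> H (x / y)).

Record subgroup := Subgroup {
  subgroup_set :> set G ;
  subgroupP : is_subgroup subgroup_set
}.

Record normal_subgroup := NormalSubgroup {
  normal_subgroup_subgroup :> subgroup ;
  normalP : forall x g : G,
    subgroup_set normal_subgroup_subgroup x ->
    subgroup_set normal_subgroup_subgroup (x ^ g)
}.

Definition generates (S : set G) : Prop := smallest is_subgroup S = [set: G].

Definition finitely_generated : Prop :=
  exists S : set G, finite_set S /\ generates S.

Definition compactly_generated : Prop :=
  exists S : set G, compact S /\ generates S.

End subgroups.

Section subgroup_lemmas.
Variables (G : topologicalGroupType) (H' : subgroup G).
Local Notation H := (subgroup_set H').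

Lemma subgroup1 : H 1. Proof. by case: (subgroupP H'). Qed.

Lemma subgroupF x y : H x -> H y -> H (x / y).
Proof. by case: (subgroupP H') => _; apply. Qed.

Lemma subgroupV x : H x -> H x^-1.
Proof. by move=> Hx; rewrite -div1g; apply: subgroupF => //; apply: subgroup1. Qed.

Lemma subgroupM x y : H x -> H y -> H (x * y).
Proof. by move=> Hx Hy; rewrite -[y]invgK; apply/subgroupF/subgroupV. Qed.

End subgroup_lemmas.

Section subgroup_type.
Variable G : topologicalGroupType.

Definition subgroup_type (H : subgroup G) : Type := set_type H.

Variable H : subgroup G.
Local Notation sH := (subgroup_type H).

HB.instance Definition _ := SubType.copy sH (set_type H).
HB.instance Definition _ := Topological.copy sH (set_type H).

Lemma subgroup_group_closed : group_closed [pred x : G | x \in (H : set G)].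
Proof.
by split=> [|x y]; rewrite !inE; [exact: subgroup1|exact: subgroupF].
Qed.

HB.instance Definition _ :=
  SubChoice_isSubGroup.Build G _ sH subgroup_group_closed.

Lemma subgroup_val_continuous : continuous (val : sH -> G).
Proof. exact: initial_continuous. Qed.

Lemma subgroup_continuous (T : topologicalType) (f : T -> sH) :
  continuous (val \o f) -> continuous f.
Proof.
move=> /continuousP cf; apply/continuousP => A [B oB <-].
exact: cf.
Qed.

Lemma subgroup_mul_continuous : continuous (fun x : sH * sH => x.1 * x.2).
Proof.
apply: subgroup_continuous => x.
rewrite (_ : _ \o _ = (fun y : G * G => y.1 * y.2) \o
  (fun y : sH * sH => (val y.1, val y.2))); last first.
  by apply/funext => y; exact: valM.
apply: continuous_comp; last exact: mulg_continuous.
by apply: cvg_pair; apply: continuous_comp;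
  [exact: cvg_fst|exact: subgroup_val_continuous
  |exact: cvg_snd|exact: subgroup_val_continuous].
Qed.

Lemma subgroup_inv_continuous : continuous (fun x : sH => x^-1).
Proof.
apply: subgroup_continuous => x.
rewrite (_ : _ \o _ = (fun y : G => y^-1) \o (val : sH -> G)); last first.
  by apply/funext => y; exact: (gmulfV (val : sH -> G)).
by apply: continuous_comp; [exact: subgroup_val_continuous
  |exact: invg_continuous].
Qed.

HB.instance Definition _ := Group_isTopologicalGroup.Build sH
  subgroup_mul_continuous subgroup_inv_continuous.

End subgroup_type.

Section coset_space.
Local Open Scope quotient_scope.
Variables (G : topologicalGroupType) (H : subgroup G).

Definition lcoset_rel : rel G := fun x y => `[< subgroup_set H (x^-1 * y) >].

Lemma lcoset_rel_equiv : equiv_class_of lcoset_rel.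
Proof.
split=> [x|x y|y x z].
- by apply/asboolP; rewrite mulVg; exact: subgroup1.
- apply/asboolP/asboolP => h.
    by rewrite -[y^-1 * x]invgK invgM invgK; exact: subgroupV.
  by rewrite -[x^-1 * y]invgK invgM invgK; exact: subgroupV.
- move=> /asboolP h1 /asboolP h2; apply/asboolP.
  by rewrite -[z](mulVKg y) mulgA; exact: subgroupM.
Qed.

Canonical lcoset_equiv := EquivRelPack lcoset_rel_equiv.

Definition coset_space : Type := quotient_topology {eq_quot lcoset_equiv}.

HB.instance Definition _ := Topological.on coset_space.
HB.instance Definition _ := Quotient.on coset_space.

Lemma lcoset_piE (x y : G) :
  \pi_coset_space x = \pi_coset_space y <-> subgroup_set H (x^-1 * y).
Proof. by split=> [/eqmodP/asboolP|h]; [|apply/eqmodP/asboolP]. Qed.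

Definition finite_index : Prop := finite_set [set: coset_space].

Definition cocompact : Prop := compact [set: coset_space].

Lemma coset_pi_open (U : set G) :
  open U -> open ((\pi_coset_space : G -> coset_space) @` U).
Proof.
move=> oU; rewrite /open /= /quotient_open.
rewrite (_ : _ @^-1` _ = \bigcup_(h in subgroup_set H) ((fun x => x * h) @^-1` U)).
  apply: bigcup_open => h Hh; apply: open_comp oU => x _.
  apply: (@continuous_comp _ _ _ (fun x => (x, h)) (fun y : G * G => y.1 * y.2)).
    by apply: cvg_pair; [exact: cvg_id|exact: cvg_cst].
  exact: mulg_continuous.
apply/seteqP; split=> [x [u Uu /lcoset_piE h]|x [h Hh /= Uxh]] /=.
  exists (x^-1 * u); last by rewrite /= mulVKg.
  by rewrite -[x^-1 * u]invgK invgM invgK; exact: subgroupV.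
exists (x * h) => //; apply/lcoset_piE.
by rewrite invgM -mulgA mulVg mulg1; exact: subgroupV.
Qed.

End coset_space.

Section quotient_group.
Local Open Scope quotient_scope.
Variables (G : topologicalGroupType) (N : normal_subgroup G).

Definition quotient_group : Type := coset_space N.

HB.instance Definition _ := Topological.on quotient_group.
HB.instance Definition _ := Quotient.on quotient_group.

Local Notation Q := quotient_group.
Local Notation pi := (\pi_Q : G -> Q).

Definition quotient_mul (x y : Q) : Q := pi (repr x * repr y).
Definition quotient_inv (x : Q) : Q := pi (repr x)^-1.
Definition quotient_one : Q := pi 1.

Lemma quotient_repr (x : G) : subgroup_set N ((repr (pi x))^-1 * x).
Proof. by apply/lcoset_piE; rewrite reprK. Qed.

Lemma quotient_piM (x y : G) : pi (x * y) = quotient_mul (pi x) (pi y).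
Proof.
apply/esym/lcoset_piE; set a := repr (pi x); set b := repr (pi y).
rewrite (_ : _ * _ = (a^-1 * x) ^ b * (b^-1 * y)); last first.
  by rewrite conjgE invgM !mulgA mulgK.
by apply: subgroupM; [apply: normalP|]; exact: quotient_repr.
Qed.

Lemma quotient_piV (x : G) : pi x^-1 = quotient_inv (pi x).
Proof.
apply/esym/lcoset_piE; set a := repr (pi x); rewrite invgK.
rewrite (_ : a / x = ((a^-1 * x) ^ a^-1)^-1); last first.
  by rewrite conjgE invgK -mulgA mulVKg invgF.
by apply: subgroupV; apply: normalP; exact: quotient_repr.
Qed.

Lemma quotient_piP (x : Q) : exists a, x = pi a.
Proof. by exists (repr x); rewrite reprK. Qed.

Lemma quotient_mulA : associative quotient_mul.
Proof.
move=> x y z.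
have [a ->] := quotient_piP x; have [b ->] := quotient_piP y.
have [c ->] := quotient_piP z.
by rewrite -!quotient_piM mulgA.
Qed.

Lemma quotient_mul1 : left_id quotient_one quotient_mul.
Proof. by move=> x; have [a ->] := quotient_piP x; rewrite /quotient_one -quotient_piM mul1g. Qed.

Lemma quotient_mulr1 : right_id quotient_one quotient_mul.
Proof. by move=> x; have [a ->] := quotient_piP x; rewrite /quotient_one -quotient_piM mulg1. Qed.

Lemma quotient_mulV : left_inverse quotient_one quotient_inv quotient_mul.
Proof.
by move=> x; have [a ->] := quotient_piP x; rewrite -quotient_piV -quotient_piM mulVg.
Qed.

Lemma quotient_mulrV : right_inverse quotient_one quotient_inv quotient_mul.
Proof.
by move=> x; have [a ->] := quotient_piP x; rewrite -quotient_piV -quotient_piM mulgV.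
Qed.

HB.instance Definition _ := isGroup.Build Q quotient_mulA quotient_mul1
  quotient_mulr1 quotient_mulV quotient_mulrV.

Lemma quotient_piMg (x y : G) : pi (x * y) = pi x * pi y.
Proof. exact: quotient_piM. Qed.

Lemma quotient_piVg (x : G) : pi x^-1 = (pi x)^-1.
Proof. exact: quotient_piV. Qed.

Lemma quotient_mul_continuous : continuous (fun x : Q * Q => x.1 * x.2).
Proof.
move=> [x y] U; rewrite nbhsE => -[V [oV Vxy] VU].
have Vr : V (pi (repr x * repr y)) by rewrite quotient_piMg !reprK.
have cpi : continuous pi by exact: pi_continuous.
have oW : open (pi @^-1` V) by apply: open_comp oV => z _; exact: cpi.
have : nbhs (repr x, repr y) ((fun z : G * G => z.1 * z.2) @^-1` (pi @^-1` V)).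
  by apply: mulg_continuous; apply: open_nbhs_nbhs; split.
move=> [[A B] /= []]; rewrite (nbhsE (repr x)) (nbhsE (repr y)) => -[A' [oA A'x] AA] [B' [oB B'y] BB] AB.
exists (pi @` A', pi @` B') => /=.
  split; apply: open_nbhs_nbhs; (split; first exact: coset_pi_open).
    by exists (repr x) => //; rewrite reprK.
  by exists (repr y) => //; rewrite reprK.
move=> [_ _] /= [[a A'a <-] [b B'b <-]]; apply: VU.
by rewrite -quotient_piMg; apply: (AB (a, b)); split; [exact: AA|exact: BB].
Qed.

Lemma quotient_inv_continuous : continuous (fun x : Q => x^-1).
Proof.
apply/quotient_continuous => x.
rewrite (_ : _ \o _ = pi \o (fun x : G => x^-1)); last first.
  by apply/funext => y /=; rewrite quotient_piVg.
by apply: continuous_comp; [exact: invg_continuous|exact: pi_continuous].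
Qed.

HB.instance Definition _ := Group_isTopologicalGroup.Build Q
  quotient_mul_continuous quotient_inv_continuous.

End quotient_group.

Section property_FM.
Variable R : realType.

Record is_mean (X : Type) (m : set X -> R) : Prop := IsMean {
  mean_ge0 : forall A, (0 <= m A)%R ;
  mean_setT : m [set: X] = 1%R ;
  mean_setU : forall A B, A `&` B = set0 -> m (A `|` B) = (m A + m B)%R
}.

Record continuous_action (G : topologicalGroupType) (X : topologicalType)
    (act : G -> X -> X) : Prop := ContinuousAction {
  action_one : forall x, act 1 x = x ;
  action_mul : forall g h x, act (g * h) x = act g (act h x) ;
  action_continuous : continuous (fun p : G * X => act p.1 p.2)
}.

Definition invariant_mean (G X : Type) (act : G -> X -> X)
    (m : set X -> R) : Prop :=
  is_mean m /\ forall g A, m (act g @` A) = m A.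

Definition property_FM (G : topologicalGroupType) : Prop :=
  forall (X : discreteTopologicalType) (act : G -> X -> X),
    continuous_action act ->
    (exists m : set X -> R, invariant_mean act m) ->
    exists x : X, finite_set (range (act^~ x)).

End property_FM.

(* Main.v *)
Require Import Defs.
From HB Require Import structures.
From mathcomp Require Import all_boot all_order all_algebra finmap.
From mathcomp Require Import all_classical all_reals.
From mathcomp Require Import topology.

Set Implicit Arguments.
Unset Strict Implicit.
Unset Printing Implicit Defensive.

Import Order.TTheory GRing.Theory Num.Theory.
Local Open Scope classical_set_scope.
Local Open Scope group_scope.

(** Everything is a manipulation of actions and means. On a discrete set, a
    continuous action is the same thing as an action with open stabilizers
    (a smooth action), and means are pushed forward along maps, restricted to
    subsets of positive measure, or obtained from ultrafilters.

    Cocompact subgroups ([property_FM_cocompact]). Let [H] act with a finite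
    orbit [F]. The map sending the coset of [g] to the translate [g F] is well
    defined and locally constant on the compact space [G/H], so it takes finitely
    many values, and these cover a [G]-orbit. An open subgroup of finite index is
    a special case.

    Open subgroups of finite index ([property_FM_open_finite_index]). An
    [H]-set [X] with invariant mean yields the induced [G]-set, modelled on
    [G/H * X]; averaging the mean over the fibres gives a [G]-invariant mean, and
    if the [G]-orbit of a point over [x] is finite, so is the [H]-orbit of [x].

    Dense images ([property_FM_dense_image]). Since stabilizers are open, a dense
    subgroup has the same orbits as the whole group.

    Extensions ([property_FM_extension]). Property FM passes to invariant subsets
    of positive mean ([property_FM_invariant_subset]). Applied to [N] acting on
    the points with infinite [N]-orbit, it shows that these points do not
    have mean one. So in the space of [N]-orbits, on which [G/N] acts, the finite orbits
    have positive mean. Property FM of [G/N] provides a finite [G/N]-orbit of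
    finite [N]-orbits, whose union contains a [G]-orbit.

    Generation ([property_FM_generates]). Fix a neighbourhood [U] of the identity
    and let [G_F] be the open subgroup generated by [U] and a finite set [F].
    On the disjoint union of the coset spaces [G/G_F], a limit of the Dirac
    masses at the base points, along an ultrafilter of ever larger [F], is
    invariant, because every [g] eventually fixes the base point. Property FM
    then forces some [G_F] to have finite index, and adding coset
    representatives to [F] generates [G]. Taking [U] compact, or reduced to the
    identity, gives both finiteness statements. *)

(** * Smooth actions and means *)

(** Continuity on a discrete set, stated without a topology on it: this lets
    property FM be tested on arbitrary types. *)
Record smooth_action (G : topologicalGroupType) (X : Type)
    (act : G -> X -> X) : Prop := SmoothAction {
  smooth_one : forall x, act 1 x = x ;
  smooth_mul : forall g h x, act (g * h) x = act g (act h x) ;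
  smooth_stabilizer : forall x, nbhs 1 [set g | act g x = x]
}.

Lemma mulgl_continuous (G : topologicalGroupType) (g : G) :
  continuous (fun x : G => g * x).
Proof.
move=> x; apply: (@continuous_comp _ _ _ (fun x => (g, x))
  (fun y : G * G => y.1 * y.2)); last exact: mulg_continuous.
by apply: cvg_pair; [exact: cvg_cst|exact: cvg_id].
Qed.

Lemma mulgr_continuous (G : topologicalGroupType) (g : G) :
  continuous (fun x : G => x * g).
Proof.
move=> x; apply: (@continuous_comp _ _ _ (fun x => (x, g))
  (fun y : G * G => y.1 * y.2)); last exact: mulg_continuous.
by apply: cvg_pair; [exact: cvg_id|exact: cvg_cst].
Qed.

Lemma conj_continuous (G : topologicalGroupType) (k : G) :
  continuous (fun g : G => k^-1 * (g * k)).
Proof.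
move=> g; apply: (@continuous_comp _ _ _ (fun h => h * k) (fun h => k^-1 * h)).
  exact: mulgr_continuous.
exact: mulgl_continuous.
Qed.

Lemma nbhs_lshift (G : topologicalGroupType) (g : G) (U : set G) :
  nbhs 1 U -> nbhs g [set h | U (g^-1 * h)].
Proof.
by move=> U1; apply: (@mulgl_continuous G g^-1 g); rewrite mulVg.
Qed.

Lemma multiplicative_one (G K : groupType) (f : {multiplicative K -> G}) :
  f 1 = 1.
Proof. by apply: (mulgI (f 1)); rewrite -gmulfM !mulg1. Qed.

Section basics.
Variables (G : topologicalGroupType) (X : Type) (act : G -> X -> X).
Hypothesis sact : smooth_action act.

Lemma smoothK g : cancel (act g) (act g^-1).
Proof. by move=> x; rewrite -(smooth_mul sact) mulVg (smooth_one sact). Qed.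

Lemma smoothVK g : cancel (act g^-1) (act g).
Proof. by move=> x; rewrite -(smooth_mul sact) mulgV (smooth_one sact). Qed.

Lemma smooth_imageE g (A : set X) : act g @` A = act g^-1 @^-1` A.
Proof.
apply/seteqP; split=> [_ [x Ax <-]|x Ax] /=; first by rewrite smoothK.
by exists (act g^-1 x); rewrite ?smoothVK.
Qed.

Lemma smooth_locally_constant g x : nbhs g [set h | act h x = act g x].
Proof.
apply: filterS (nbhs_lshift g (smooth_stabilizer sact x)) => h /= hx.
by rewrite -{2}hx -(smooth_mul sact) mulVKg.
Qed.

(** Transporters are cosets of stabilizers; their openness is what turns
    topological hypotheses on a group into statements on its orbits. *)
Lemma smooth_transporter_open x y : open [set g | act g x = y].
Proof.
by rewrite openE => g /= <-; exact: smooth_locally_constant.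
Qed.

Lemma smooth_comp (K : topologicalGroupType) (f : {multiplicative K -> G}) :
  continuous f -> smooth_action (act \o f).
Proof.
move=> cf; split=> [x|g h x|x] /=.
- by rewrite multiplicative_one (smooth_one sact).
- by rewrite gmulfM (smooth_mul sact).
- apply: (cf 1 [set g | act g x = x]).
  by rewrite multiplicative_one; exact: smooth_stabilizer.
Qed.

End basics.

Lemma continuous_actionP (G : topologicalGroupType)
    (X : discreteTopologicalType) (act : G -> X -> X) :
  continuous_action act <-> smooth_action act.
Proof.
split=> [[a1 aM ac]|sact]; split.
- exact: a1.
- exact: aM.
- move=> x.
  have c : {for 1, continuous (fun g : G => act g x)}.
    apply: (@continuous_comp _ _ _ (fun g => (g, x))
      (fun p : G * X => act p.1 p.2)); last exact: ac.
    by apply: cvg_pair; [exact: cvg_id|exact: cvg_cst].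
  by apply: (c [set x]); rewrite a1; exact: discrete_set1.
- exact: smooth_one.
- exact: smooth_mul.
- move=> [g x] /= U /nbhs_singleton Ugx.
  exists ([set h | act h x = act g x], [set x]) => /=.
    by split; [exact: smooth_locally_constant|exact: discrete_set1].
  by move=> [h y] [/= e ->] /=; rewrite e.
Qed.

Section means.
Variable R : realType.
Local Open Scope ring_scope.

(** Any type carries the discrete topology, so the topology on the set acted
    upon can be dropped from property FM. *)
Lemma property_FMP (G : topologicalGroupType) :
  property_FM R G <->
  forall (X : Type) (act : G -> X -> X) (m : set X -> R),
    smooth_action act -> invariant_mean act m ->
    exists x : X, finite_set (range (act^~ x)).
Proof.
split=> FM X act.
  move=> m sact im; apply: (FM (discrete_topology {classic X}) act).
    exact/continuous_actionP.
  by exists m.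
by move=> /continuous_actionP sact [m im]; exact: FM sact im.
Qed.

Lemma mean_setC (X : Type) (m : set X -> R) A :
  is_mean m -> m A + m (~` A) = 1.
Proof.
by move=> mm; rewrite -(mean_setU mm) ?setICr// setUCr (mean_setT mm).
Qed.

Lemma mean_pushforward (X Y : Type) (p : X -> Y) (m : set X -> R) :
  is_mean m -> is_mean (fun B => m (p @^-1` B)).
Proof.
move=> mm; split=> [A||A B AB].
- exact: mean_ge0.
- exact: mean_setT.
- rewrite preimage_setU (mean_setU mm)//.
  by rewrite -preimage_setI AB preimage_set0.
Qed.

(** Group elements act bijectively, so invariance may be checked on preimages,
    which commute with pushforwards of means. *)
Lemma invariant_mean_preimage (G : topologicalGroupType) (X : Type)
    (act : G -> X -> X) (m : set X -> R) :
  smooth_action act -> is_mean m ->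
  (forall g A, m (act g @^-1` A) = m A) -> invariant_mean act m.
Proof.
by move=> sact mm mi; split=> // g A; rewrite (smooth_imageE sact).
Qed.

Lemma invariant_mean_preimageE (G : topologicalGroupType) (X : Type)
    (act : G -> X -> X) (m : set X -> R) g A :
  smooth_action act -> invariant_mean act m -> m (act g @^-1` A) = m A.
Proof.
by move=> sact [_ mi]; rewrite -[g]invgK -(smooth_imageE sact) mi.
Qed.

(** The mean restricted to the subset and divided by its mass is again an
    invariant mean; this confines the finite orbit to any prescribed invariant
    subset that is not negligible. *)
Lemma property_FM_invariant_subset (G : topologicalGroupType) (X : Type)
    (act : G -> X -> X) (m : set X -> R) (Y : set X) :
  property_FM R G -> smooth_action act -> invariant_mean act m ->
  (forall g x, Y x -> Y (act g x)) -> 0 < m Y ->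
  exists2 x, Y x & finite_set (range (act^~ x)).
Proof.
move=> /property_FMP FM sact im Yact mY; have [mm mi] := im.
pose T := {x : X | Y x}.
pose actT g (x : T) : T := exist _ (act g (sval x)) (Yact g _ (svalP x)).
pose mT (A : set T) := m (sval @` A) / m Y.
have svalI : injective (sval : T -> X).
  by move=> x y /eq_sig_hprop; apply=> z p q; exact: Prop_irrelevance.
have sT : smooth_action actT.
  split=> [x|g h x|x].
  - by apply: svalI; rewrite /= (smooth_one sact).
  - by apply: svalI; rewrite /= (smooth_mul sact).
  - apply: filterS (smooth_stabilizer sact (sval x)) => g /= gx.
    exact: svalI.
have imT : invariant_mean actT mT.
  split; first split.
  - by move=> A; rewrite divr_ge0 ?(mean_ge0 mm).
  - suff -> : mT [set: T] = m Y / m Y by rewrite divff ?gt_eqF.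
    congr (m _ / _).
    apply/seteqP; split=> [_ [x _ <-]|x Yx]; first exact: svalP.
    by exists (exist _ x Yx); [exact: I|exact: erefl].
  - move=> A B AB; rewrite /mT image_setU (mean_setU mm) ?mulrDl//.
    rewrite -subset0 => _ [[x Ax <-] [y By /svalI yx]].
    have : (A `&` B) x by split=> //; rewrite -yx.
    by rewrite AB.
  - move=> g A; rewrite /mT -(mi g (sval @` A)); congr (m _ / _).
    by rewrite !image_comp.
have [x xfin] := FM _ _ _ sT imT.
exists (sval x); first exact: svalP.
have := finite_image sval xfin; rewrite image_comp; exact.
Qed.

End means.

(** * Dense images and quotients *)

Section images.
Variable R : realType.

(** If a translate [h x] is given, the set of group elements moving [x] to [h x]
    is open and nonempty, so it meets the dense image: both groups have the same
    orbit through [x]. *)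
Lemma property_FM_dense_image (G H : topologicalGroupType)
    (f : {multiplicative G -> H}) :
  continuous f -> dense (range f) -> property_FM R G -> property_FM R H.
Proof.
move=> cf fdense /property_FMP FM; apply/property_FMP => X act m sact [mm mi].
have im : invariant_mean (act \o f) m by split=> // g A; exact: mi.
have [x xfin] := FM X _ m (smooth_comp sact cf) im.
exists x; apply: sub_finite_set xfin => _ [h _ <-].
have hopen := smooth_transporter_open sact x (act h x).
have [|y [yx [g _ fg]]] := fdense _ _ hopen.
  by exists h.
by exists g => //=; rewrite fg.
Qed.

Lemma quotient_pi_multiplicative (G : topologicalGroupType)
    (N : normal_subgroup G) :
  {morph (\pi_(quotient_group N) : G -> quotient_group N)%qT : x y / x * y}.
Proof. exact: quotient_piMg. Qed.

HB.instance Definition _ (G : topologicalGroupType) (N : normal_subgroup G) :=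
  isMultiplicative.Build G (quotient_group N)
    (\pi_(quotient_group N))%qT (@quotient_pi_multiplicative G N).

Lemma property_FM_quotient (G : topologicalGroupType) (N : normal_subgroup G) :
  property_FM R G -> property_FM R (quotient_group N).
Proof.
apply: (@property_FM_dense_image G _ (\pi_(quotient_group N))%qT).
  exact: pi_continuous.
move=> O [q Oq] _; exists q; split=> //.
by exists (repr q) => //; exact: reprK.
Qed.

End images.

(** * Cocompact subgroups *)

Section cocompact_subgroups.
Variable R : realType.

(** A finite intersection of open point stabilizers fixes [F] pointwise. *)
Lemma smooth_image_stabilizer (G : topologicalGroupType) (X : Type)
    (act : G -> X -> X) (F : set X) :
  smooth_action act -> finite_set F -> nbhs 1 [set g | act g @` F = F].
Proof.
move=> sact /(@finite_fsetP {classic X})[F' ->].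
have := @filter_bigI _ {classic X} F' (fun x => [set g | act g x = x]).
move=> /(_ (nbhs (1 : G)) _ (fun x _ => smooth_stabilizer sact x)).
apply: filterS => g gF; apply/seteqP; split=> [_ [x Fx <-]|x Fx] /=.
  by rewrite (gF x).
by exists x => //; exact: gF.
Qed.

Lemma smooth_imageM (G : topologicalGroupType) (X : Type)
    (act : G -> X -> X) g h (A : set X) :
  smooth_action act -> act (g * h) @` A = act g @` (act h @` A).
Proof.
by move=> sact; rewrite image_comp; apply: eq_imagel => x _; exact: smooth_mul.
Qed.

Lemma range_subgroup_act (G : topologicalGroupType) (H : subgroup G)
    (X : Type) (act : G -> X -> X) x :
  range ((act \o (val : subgroup_type H -> G))^~ x) = act^~ x @` (H : set G).
Proof.
apply/seteqP; split=> [_ [h _ <-]|_ [h Hh <-]] /=.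
  by exists (val h) => //; exact: set_mem (valP h).
by exists (Sub h (mem_set Hh)).
Qed.

(** The filter of eventual properties of finite sets directed by inclusion. *)
Definition fset_filter (T : choiceType) : set_system {fset T} :=
  [set P | exists A : {fset T}, forall B, (A `<=` B)%fset -> P B].

Lemma fset_filter_proper (T : choiceType) : ProperFilter (@fset_filter T).
Proof.
split; first by move=> [A] /(_ A (fsubset_refl A)).
split=> [|P Q [A AP] [B BQ]|P Q PQ [A AP]].
- by exists fset0.
- exists (A `|` B)%fset => C; rewrite fsubUset => /andP[AC BC].
  by split; [exact: AP|exact: BQ].
- by exists A => B AB; apply/PQ/AP.
Qed.

Lemma fset_filter_mem (T : choiceType) (x : T) :
  @fset_filter T [set A | x \in A].
Proof. by exists [fset x]%fset => A; rewrite fsub1set. Qed.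

(** Finitely many of the open fibres cover [K]. Compactness is used through
    near-coverings: for finite sets [A] of values growing along [fset_filter],
    each point of [K] eventually has [f x] in [A], hence so does all of [K]
    simultaneously. *)
Lemma compact_locally_constant (T : topologicalType) (K : set T) (Y : Type)
    (f : T -> Y) :
  compact K -> (forall x, K x -> nbhs x [set y | f y = f x]) ->
  finite_set (f @` K).
Proof.
move=> /compact_near_coveringP cK fcst.
have FF := fset_filter_proper {classic Y}.
pose P (A : {fset {classic Y}}) x : Prop := (f x : {classic Y}) \in A.
have [|A /(_ _ (fsubset_refl A)) KA] := cK _ _ P FF.
  move=> x Kx; exists ([set y | f y = f x], P^~ x).
    by split; [exact: fcst|exact: fset_filter_mem].
  by move=> [y A] /= [fyx]; rewrite /P fyx.
apply: (@sub_finite_set {classic Y} _ [set` A]); last exact: finite_fset.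
by move=> _ [x Kx <-]; exact: KA.
Qed.

(** A finite [H]-orbit [F] has finitely many translates, since [g F] depends only
    on the coset [g H], locally constantly, and [G/H] is compact. *)
Lemma property_FM_cocompact (G : topologicalGroupType) (H : subgroup G) :
  cocompact H -> property_FM R (subgroup_type H) -> property_FM R G.
Proof.
move=> Gcpt /property_FMP FM; apply/property_FMP => X act m sact [mm mi].
have im : invariant_mean (act \o (val : subgroup_type H -> G)) m.
  by split=> // g A; exact: mi.
have [x] := FM X _ m (smooth_comp sact (@subgroup_val_continuous G H)) im.
rewrite range_subgroup_act; set F := _ @` _ => Ffin; exists x.
pose pi : G -> coset_space H := \pi_(coset_space H)%qT.
have actH : forall g k, pi g = pi k -> act g @` F = act k @` F.
  have sub g k : pi g = pi k -> act g @` F `<=` act k @` F.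
    move=> /esym/lcoset_piE Hkg _ [_ [h Hh <-] <-].
    exists (act (k^-1 * g * h) x).
      by exists (k^-1 * g * h) => //; exact: subgroupM.
    by rewrite -!(smooth_mul sact) -mulgA mulVKg.
  by move=> g k gk; apply/seteqP; split; apply: sub.
have fin :
    finite_set [set act (repr c) @` F | c in [set: coset_space H]].
  apply: compact_locally_constant Gcpt _ => c _.
  have co : open (pi @` [set g | act g @` F = act (repr c) @` F]).
    apply: coset_pi_open; rewrite openE => g /= gF.
    have nF := smooth_image_stabilizer sact Ffin.
    apply: filterS (nbhs_lshift g nF) => h /= hF.
    by rewrite -gF -[in RHS]hF -(smooth_imageM _ _ _ sact) mulVKg.
  apply: filterS (open_nbhs_nbhs (conj co _)) => [_ [g /= gF <-]|] /=.
    by rewrite -gF; apply: actH; exact: reprK.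
  by exists (repr c) => //; exact: reprK.
apply: (@sub_finite_set _ _ (\bigcup_(A in
  [set act (repr c) @` F | c in [set: coset_space H]]) A)).
  move=> _ [g _ <-]; exists (act g @` F).
    by exists (pi g) => //; apply: actH; exact: reprK.
  exists x => //; exists 1; [exact: subgroup1|exact: smooth_one].
by apply: bigcup_finite => // _ [c _ <-]; exact: finite_image.
Qed.

End cocompact_subgroups.

(** * Open subgroups of finite index *)

Section finite_index_subgroups.
Variable R : realType.

Lemma open_subgroup_nbhs1 (G : topologicalGroupType) (H : subgroup G)
    (V : set (subgroup_type H)) :
  open (H : set G) -> nbhs 1 V ->
  nbhs (1 : G) (val @` V).
Proof.
move=> Hop; rewrite nbhsE => -[_ [[B oB <-] B1] BV].
have H1 : (B `&` (H : set G)) 1.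
  split; last exact: subgroup1.
  by rewrite -(val1 (subgroup_type H)).
apply: filterS (open_nbhs_nbhs (conj (openI oB Hop) H1)) => g [Bg Hg].
exists (Sub g (mem_set Hg)); last exact: erefl.
by apply: BV.
Qed.

(** The induced [G]-set is the quotient of [G * X] by [H]. Choosing a
    representative [repr c] of each coset [c] identifies it with [G/H * X], with
    [G] acting on the second factor through an [H]-valued cocycle. *)
Section induction.
Variables (G : topologicalGroupType) (H : subgroup G).
Variables (X : Type) (act : subgroup_type H -> X -> X).
Hypothesis sact : smooth_action act.

Let pi : G -> coset_space H := \pi_(coset_space H)%qT.
(* applied to elements of [H] only, where it is the inverse of [val] *)
Let toH : G -> subgroup_type H := insubd 1.

Let piK c : pi (repr c) = c. Proof. exact: reprK. Qed.

Let toHK g : (H : set G) g -> val (toH g) = g.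
Proof. by move=> Hg; apply: insubdK; exact: mem_set. Qed.

Let toHM g h : (H : set G) g -> (H : set G) h -> toH (g * h) = toH g * toH h.
Proof.
move=> Hg Hh; apply: val_inj; rewrite (toHK (subgroupM Hg Hh)).
by rewrite -[in LHS](toHK Hg) -[in LHS](toHK Hh).
Qed.

Let toH_val h : toH (val h) = h.
Proof. exact: valKd. Qed.

Definition coset_cocycle (g : G) (c : coset_space H) : G :=
  (repr (pi (g * repr c)))^-1 * (g * repr c).

Definition induced_act (g : G) (y : coset_space H * X) : coset_space H * X :=
  (pi (g * repr y.1), act (toH (coset_cocycle g y.1)) y.2).

Lemma coset_cocycleP g c : (H : set G) (coset_cocycle g c).
Proof. by apply/lcoset_piE; rewrite reprK. Qed.

Lemma coset_mul_repr g k : pi (g * repr (pi k)) = pi (g * k).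
Proof.
apply/lcoset_piE; rewrite invgM -mulgA mulKg; apply/lcoset_piE.
by rewrite reprK.
Qed.

Lemma coset_cocycleM g h c :
  coset_cocycle (g * h) c =
  coset_cocycle g (pi (h * repr c)) * coset_cocycle h c.
Proof.
rewrite /coset_cocycle coset_mul_repr -!mulgA mulVKg.
by rewrite !mulgA.
Qed.

Lemma coset_mul_bij g : bijective (fun c : coset_space H => pi (g * repr c)).
Proof.
exists (fun c => pi (g^-1 * repr c)) => c; rewrite coset_mul_repr.
  by rewrite mulKg piK.
by rewrite mulVKg piK.
Qed.

(** The stabilizer of the coset [c] is the conjugate of [H] by [repr c], and on
    it the cocycle is conjugation; this gives the action on the fibre over [c]. *)
Lemma coset_cocycle_fix g c : (H : set G) ((repr c)^-1 * (g * repr c)) ->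
  pi (g * repr c) = c /\ coset_cocycle g c = (repr c)^-1 * (g * repr c).
Proof.
move=> /lcoset_piE; rewrite -/(pi (repr c)) piK => /esym e; split=> //.
by rewrite /coset_cocycle [pi _]e.
Qed.

(** An element close to the identity has its conjugate by [repr c] in [H], by
    openness of [H], and close to the identity there: it fixes [c], and then
    [x]. *)
Lemma induced_act_smooth : open (H : set G) -> smooth_action induced_act.
Proof.
move=> Hop; split=> [[c x]|g h [c x]|[c x]]; rewrite /induced_act /=.
- have [|-> ->] := @coset_cocycle_fix 1 c.
    by rewrite mul1g mulVg; exact: subgroup1.
  by rewrite mul1g mulVg -(val1 (subgroup_type H)) toH_val (smooth_one sact).
- rewrite coset_cocycleM toHM; [|exact: coset_cocycleP..].
  by rewrite (smooth_mul sact) -mulgA coset_mul_repr.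
- have nb := open_subgroup_nbhs1 Hop (smooth_stabilizer sact x).
  have : nbhs (1 : G) [set g | (val @` [set h | act h x = x])
      ((repr c)^-1 * (g * repr c))].
    apply: (@conj_continuous G (repr c) 1 (val @` [set h | act h x = x])).
    by rewrite mul1g mulVg.
  apply: filterS => g /= [h hx hE].
  have [|-> ->] := @coset_cocycle_fix g c.
    by rewrite -hE; exact: set_mem (valP h).
  by rewrite -hE toH_val hx.
Qed.

(** The conjugate of [H] by [repr c] preserves the fibre over [c] and acts on it
    as [H] acts on [X]. *)
Lemma induced_orbit_finite c x :
  finite_set (range (induced_act^~ (c, x))) -> finite_set (range (act^~ x)).
Proof.
move=> /(finite_image snd); apply: sub_finite_set => _ [h _ <-].
have Hh : (H : set G) (val h) by exact: set_mem (valP h).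
pose g := repr c * val h / repr c.
have gE : (repr c)^-1 * (g * repr c) = val h.
  by rewrite /g mulgVK mulKg.
have [|e1 e2] := @coset_cocycle_fix g c; first by rewrite gE.
exists (induced_act g (c, x)); first by exists g.
by rewrite /induced_act /= e2 gE toH_val.
Qed.

Local Open Scope ring_scope.

Definition induced_mean (m : set X -> R) (A : set (coset_space H * X)) : R :=
  (\sum_(c \in [set: coset_space H]) m [set x | A (c, x)]) /
  (\sum_(c \in [set: coset_space H]) (1 : R)).

(** An element [g] permutes the fibres and goes from one fibre to its image
    through an element of [H], which preserves [m]; so [g] only permutes the terms
    of the sum over [G/H]. *)
Lemma induced_mean_invariant (m : set X -> R) :
  open (H : set G) -> finite_index H -> invariant_mean act m ->
  invariant_mean induced_act (induced_mean m).
Proof.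
move=> Hop fi im; have [mm mi] := im; have sY := induced_act_smooth Hop.
have card_neq0 : (\sum_(c \in [set: coset_space H]) (1 : R)) != 0.
  apply/eqP => /pfsumr_eq0 => /(_ fi (fun _ _ => ler01) (pi 1%g) I) /eqP.
  by rewrite oner_eq0.
apply: invariant_mean_preimage => //; first split.
- move=> A; rewrite divr_ge0// fsumr_ge0// => c _; exact: mean_ge0.
- rewrite /induced_mean -[RHS](divff card_neq0); congr (_ / _).
  by apply: eq_fsbigr => c _; exact: mean_setT.
- move=> A B AB; rewrite /induced_mean -mulrDl -fsbig_split//; congr (_ / _).
  apply: eq_fsbigr => c _; apply: (@mean_setU _ _ _ mm [set x | A (c, x)]).
  by rewrite -subset0 => x [Ax Bx]; have : (A `&` B) (c, x) by []; rewrite AB.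
- move=> g A; rewrite /induced_mean; congr (_ / _).
  rewrite [RHS](reindex_fsbigT _ _ (coset_mul_bij g)).
  apply: eq_fsbigr => c _.
  pose h := toH (coset_cocycle g c).
  by rewrite -[RHS](invariant_mean_preimageE h _ sact im).
Qed.

End induction.

Lemma property_FM_open_finite_index (G : topologicalGroupType)
    (H : subgroup G) :
  open (H : set G) -> finite_index H ->
  property_FM R G -> property_FM R (subgroup_type H).
Proof.
move=> Hop fi /property_FMP FM; apply/property_FMP => X act m sact im.
have [[c x] fin] := FM _ _ _ (induced_act_smooth sact Hop)
  (induced_mean_invariant sact Hop fi im).
by exists x; exact: induced_orbit_finite fin.
Qed.

End finite_index_subgroups.

(** * Extensions *)

Section extensions.
Variables (R : realType) (G : topologicalGroupType) (N : normal_subgroup G).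
Variables (X : Type) (act : G -> X -> X).
Hypothesis sact : smooth_action act.

Local Notation NG := (subgroup_set N).
Local Notation Q := (quotient_group N).
Let pi : G -> Q := \pi_Q%qT.

Definition sub_orbit (x : X) : set X := act^~ x @` NG.

Lemma sub_orbit_refl x : sub_orbit x x.
Proof. by exists 1; [exact: subgroup1|exact: smooth_one]. Qed.

Lemma sub_orbit_act n x : NG n -> sub_orbit (act n x) = sub_orbit x.
Proof.
move=> Nn; apply/seteqP; split=> _ [k Nk <-].
  by exists (k * n); [exact: subgroupM|exact: smooth_mul].
exists (k / n); first exact: subgroupF.
by rewrite -(smooth_mul sact) mulgVK.
Qed.

(** Normality of [N]: translation by [g] conjugates [N] to itself, and so
    permutes the [N]-orbits. *)
Lemma sub_orbit_translate g x : sub_orbit (act g x) = act g @` sub_orbit x.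
Proof.
apply/seteqP; split=> [_ [n Nn <-]|_ [_ [n Nn <-] <-]].
  exists (act (n ^ g) x); first by exists (n ^ g) => //; exact: Defs.normalP.
  by rewrite -!(smooth_mul sact) conjgE mulVKg.
exists (n ^ g^-1); first exact: Defs.normalP.
by rewrite -!(smooth_mul sact) conjgE invgK -!mulgA mulVg mulg1.
Qed.

Definition orbit_space := {A : set X | exists x, A = sub_orbit x}.

Definition orbit_proj (x : X) : orbit_space :=
  exist _ (sub_orbit x) (ex_intro _ x erefl).

Lemma orbit_projP (z : orbit_space) : {x | z = orbit_proj x}.
Proof.
case: z => A Aorb; have [x xA] := cid Aorb; exists x.
exact: eq_exist.
Qed.

Definition orbit_repr (z : orbit_space) : X := sval (orbit_projP z).

Lemma orbit_proj_eq x y :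
  orbit_proj x = orbit_proj y -> exists2 n, NG n & x = act n y.
Proof.
move=> [e]; have : sub_orbit y x by rewrite -e; exact: sub_orbit_refl.
by move=> [n Nn <-]; exists n.
Qed.

Lemma orbit_proj_act n x : NG n -> orbit_proj (act n x) = orbit_proj x.
Proof. by move=> Nn; apply: eq_exist; exact: sub_orbit_act. Qed.

(** Representatives are chosen to define the action on all of [quotient_group N];
    independence of the choices is [orbit_actE]. *)
Definition orbit_act (q : Q) (z : orbit_space) : orbit_space :=
  orbit_proj (act (repr q) (orbit_repr z)).

Lemma orbit_actE g x : orbit_act (pi g) (orbit_proj x) = orbit_proj (act g x).
Proof.
rewrite /orbit_act.
have [n Nn ->] : exists2 n, NG n & orbit_repr (orbit_proj x) = act n x.
  apply: orbit_proj_eq; rewrite /orbit_repr; by case: orbit_projP.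
set k := repr (pi g).
have Nu : NG (k^-1 * g) by exact: quotient_repr.
have -> : act g x = act ((k^-1 * g / n) ^ k^-1) (act k (act n x)).
  rewrite -!(smooth_mul sact) conjgE invgK; congr (act _ x).
  by rewrite -!mulgA mulVKg mulKg mulVg mulg1.
by rewrite [RHS]orbit_proj_act//; apply: Defs.normalP; exact: subgroupF.
Qed.

Let piP (q : Q) : exists g, q = pi g.
Proof. by exists (repr q); rewrite /pi reprK. Qed.

Lemma orbit_act_smooth : smooth_action orbit_act.
Proof.
split=> [z|q r z|z]; have [x ->] := orbit_projP z.
- by rewrite (orbit_actE 1) (smooth_one sact).
- have [g ->] := piP q; have [h ->] := piP r.
  by rewrite -quotient_piMg !orbit_actE (smooth_mul sact).
- have op := @coset_pi_open _ N _ (smooth_transporter_open sact x x).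
  have op1 : (pi @` [set g | act g x = x]) 1.
    by exists 1 => //; exact: smooth_one.
  apply: filterS (open_nbhs_nbhs (conj op op1)) => _ [g /= gx <-].
  by rewrite [LHS]orbit_actE gx.
Qed.

Lemma orbit_mean_invariant (m : set X -> R) : invariant_mean act m ->
  invariant_mean orbit_act (fun B => m (orbit_proj @^-1` B)).
Proof.
move=> im; have [mm mi] := im.
apply: (invariant_mean_preimage orbit_act_smooth).
  exact: mean_pushforward.
move=> q B; have [g ->] := piP q.
rewrite -[RHS](invariant_mean_preimageE g _ sact im); congr (m _).
by apply/seteqP; split=> x /=; rewrite orbit_actE.
Qed.

(** Otherwise the points with infinite [N]-orbit form an invariant set of full
    mean, in which property FM of [N] finds a finite orbit. *)
Lemma mean_finite_sub_orbit_gt0 (m : set X -> R) :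
  property_FM R (subgroup_type N) -> invariant_mean act m ->
  (0 < m [set x | finite_set (sub_orbit x)])%R.
Proof.
move=> FMN [mm mi]; set Y := [set x | _].
rewrite lt_def (mean_ge0 mm) andbT; apply/eqP => mY0.
have im : invariant_mean (act \o (val : subgroup_type N -> G)) m.
  by split=> // g A; exact: mi.
have sN := smooth_comp sact (@subgroup_val_continuous G N).
have [|| x nYx] := property_FM_invariant_subset (Y := ~` Y) FMN sN im.
- move=> n x nYx; rewrite /Y /= sub_orbit_act//; exact: set_mem (valP n).
- by have := mean_setC Y mm; rewrite mY0 add0r => ->; exact: ltr01.
- by rewrite range_subgroup_act.
Qed.

End extensions.

(** A finite [G/N]-orbit made of finite [N]-orbits has a finite union, and it
    contains a [G]-orbit. *)
Lemma property_FM_extension (R : realType) (G : topologicalGroupType)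
    (N : normal_subgroup G) :
  property_FM R (subgroup_type N) -> property_FM R (quotient_group N) ->
  property_FM R G.
Proof.
move=> FMN FMQ; apply/property_FMP => X act m sact im.
pose W := [set z : orbit_space N act | finite_set (sval z)].
have Wact : forall q z, W z -> W (orbit_act q z).
  move=> q z; have [x ->] := orbit_projP z.
  rewrite -[q]reprK (orbit_actE N sact) /W /= (sub_orbit_translate N sact).
  exact: finite_image.
have mW := mean_finite_sub_orbit_gt0 sact FMN im.
have [z Wz fin] := property_FM_invariant_subset FMQ
  (orbit_act_smooth N sact) (orbit_mean_invariant N sact im) Wact mW.
have [x zx] := orbit_projP z; exists x.
pose B : set X :=
  \bigcup_(y in [set orbit_act q z | q in [set: quotient_group N]]) sval y.
apply: (@sub_finite_set X _ B).
  move=> _ [g _ <-]; exists (orbit_proj N act (act g x)).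
    exists (\pi_(quotient_group N) g)%qT => //.
    by rewrite zx (orbit_actE N sact).
  exact: sub_orbit_refl.
by apply: bigcup_finite => // _ [q _ <-]; exact: Wact.
Qed.

(** * Generation *)

Section generation.
Variable R : realType.

(** Of two disjoint sets at most one belongs to an ultrafilter, and exactly one
    when their union does: this is additivity of the 0-1 valued mean. *)
Lemma ultrafilter_mean (I : Type) (F : set_system I) : UltraFilter F ->
  is_mean (fun A => (`[< F A >]%:R : R)%R).
Proof.
move=> UF; have PF := ultra_proper; split.
- by move=> A; exact: ler0n.
- by rewrite asboolT//; exact: filterT.
- move=> A B AB.
  have [FA|nFA] := pselect (F A).
    rewrite (asboolT FA) (asboolT (filterS (@subsetUl _ A B) FA)).
    rewrite asboolF ?addr0// => FB.
    by apply: (@filter_not_empty _ F); rewrite -AB; exact: filterI.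
  rewrite (asboolF nFA) add0r; congr (_%:R)%R; congr (nat_of_bool _).
  apply: asbool_equiv_eq; split=> [FAB|]; last first.
    by apply: filterS; exact: subsetUr.
  have [//|FnA] := in_ultra_setVsetC A UF.
  by apply: filterS (filterI FAB FnA) => x [[]].
Qed.

Lemma subgroup_generated (G : topologicalGroupType) (S : set G) :
  is_subgroup (smallest (@is_subgroup G) S).
Proof.
split=> [|x y Sx Sy] K KS; have [[K1 KF] _] := KS.
  exact: K1.
by apply: KF; [exact: Sx|exact: Sy].
Qed.

Section cosets.
Variables (G : topologicalGroupType) (U : set G).
Hypothesis U1 : nbhs 1 U.

Definition gen (F : {fset G}) : subgroup G :=
  Subgroup (subgroup_generated (U `|` [set` F])).

Lemma gen_nbhs F : nbhs 1 (gen F : set G).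
Proof. by apply: filterS U1 => x Ux K [_]; apply; left. Qed.

Lemma gen_mem (F : {fset G}) x : x \in F -> (gen F : set G) x.
Proof. by move=> xF K [_]; apply; right. Qed.

(** All left cosets of all the subgroups [gen F], as subsets of [G]. Cosets of
    distinct subgroups are distinct sets, so this is the disjoint union of the
    coset spaces, except that it counts each subgroup once. *)
Definition gen_coset :=
  {A : set G | exists g F, A = ( *%g g) @` (gen F : set G)}.

Definition to_gen_coset g F : gen_coset :=
  exist _ (( *%g g) @` (gen F : set G)) (ex_intro _ g (ex_intro _ F erefl)).

Lemma mul_image g h (A : set G) :
  ( *%g g) @` (( *%g h) @` A) = ( *%g (g * h)) @` A.
Proof. by rewrite image_comp; apply: eq_imagel => x _ /=; rewrite mulgA. Qed.

Lemma gen_coset_subproof g (A : gen_coset) :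
  exists h F, ( *%g g) @` sval A = ( *%g h) @` (gen F : set G).
Proof.
by case: A => A [h [F /= ->]]; exists (g * h), F; exact: mul_image.
Qed.

Definition gen_coset_act g (A : gen_coset) : gen_coset :=
  exist _ (( *%g g) @` sval A) (gen_coset_subproof g A).

Lemma gen_coset_actE g h F :
  gen_coset_act g (to_gen_coset h F) = to_gen_coset (g * h) F.
Proof. by apply: eq_exist; exact: mul_image. Qed.

Lemma gen_cosetP (A : gen_coset) : exists g F, A = to_gen_coset g F.
Proof. by case: A => A [g [F AE]]; exists g, F; exact: eq_exist. Qed.

Lemma to_gen_coset_eq g h F :
  to_gen_coset g F = to_gen_coset h F <-> (gen F : set G) (g^-1 * h).
Proof.
split=> [/(congr1 sval) e|Fgh].
  have {}e : ( *%g g) @` (gen F : set G) = ( *%g h) @` (gen F : set G) := e.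
  have : (( *%g g) @` (gen F : set G)) h.
    by rewrite e; exists 1; [exact: subgroup1|exact: mulg1].
  by move=> [k Fk <-]; rewrite mulKg.
apply: eq_exist; apply/seteqP; split=> _ [k Fk <-].
  exists ((g^-1 * h)^-1 * k); first by apply: subgroupM => //; exact: subgroupV.
  by rewrite invgM invgK !mulgA mulgV mul1g.
exists (g^-1 * h * k); first exact: subgroupM.
by rewrite -mulgA mulVKg.
Qed.

Lemma gen_coset_smooth : smooth_action gen_coset_act.
Proof.
split=> [A|g h A|A]; have [k [F ->]] := gen_cosetP A.
- by rewrite gen_coset_actE mul1g.
- by rewrite !gen_coset_actE mulgA.
- have : nbhs (1 : G) [set g | (gen F : set G) (k^-1 * (g * k))].
    apply: (@conj_continuous G k 1 (gen F : set G)).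
    by rewrite mul1g mulVg; exact: gen_nbhs.
  apply: filterS => g /= Fg; rewrite gen_coset_actE; apply/esym.
  exact/to_gen_coset_eq.
Qed.

(** The limit of the Dirac masses at [gen F], for [F] growing along an ultrafilter
    finer than [fset_filter]: an element [g] fixes [gen F] as soon as [F]
    contains [g]. *)
Lemma gen_coset_mean : exists m : set gen_coset -> R,
  invariant_mean gen_coset_act m.
Proof.
have [F [UF fF]] := ultraFilterLemma (fset_filter_proper G).
have PF := ultra_proper.
exists (fun A => (`[< F (to_gen_coset 1 @^-1` A) >]%:R)%R).
apply: (invariant_mean_preimage gen_coset_smooth).
  exact: mean_pushforward (ultrafilter_mean UF).
move=> g A; congr (_%:R)%R; congr (nat_of_bool _).
have Fg : F [set S | gen_coset_act g (to_gen_coset 1 S) = to_gen_coset 1 S].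
  apply: filterS (fF _ (fset_filter_mem g)) => S /= gS.
  rewrite gen_coset_actE mulg1; apply/to_gen_coset_eq; rewrite mulg1.
  by apply: subgroupV; exact: gen_mem.
apply: asbool_equiv_eq; split=> FA.
  by apply: filterS (filterI Fg FA) => S /= [->].
by apply: filterS (filterI Fg FA) => S /= [->].
Qed.

(** A finite orbit of cosets of [gen F] means that [gen F] has finite index, so
    adding representatives of its cosets to [F] generates the whole group. *)
Lemma property_FM_generates : property_FM R G ->
  exists F : {fset G}, generates (U `|` [set` F]).
Proof.
move=> /property_FMP FM; have [m im] := gen_coset_mean.
have [A] := FM _ _ _ gen_coset_smooth im.
have [k [F ->]] := gen_cosetP A => fin.
have {}fin : finite_set (range (to_gen_coset^~ F)).
  apply: sub_finite_set fin => _ [g _ <-]; exists (g / k) => //.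
  by rewrite gen_coset_actE mulgVK.
(* [s] picks a representative of each coset of [gen F]; elsewhere its value is
   arbitrary *)
pose s A := xget 1 [set g | to_gen_coset g F = A].
have [D DE] : exists D : {fset G}, s @` range (to_gen_coset^~ F) = [set` D].
  exact/finite_fsetP/finite_image.
exists (F `|` D)%fset; apply/seteqP; split=> // g _.
pose h := s (to_gen_coset g F).
have hD : h \in D.
  suff : [set` D] h by [].
  by rewrite -DE; exists (to_gen_coset g F) => //; exists g.
have /to_gen_coset_eq hg : to_gen_coset h F = to_gen_coset g F.
  by rewrite /h /s; case: xgetP => [y _ //|/(_ g)]; case.
have FFD : (gen F : set G) `<=` gen (F `|` D)%fset.
  apply: smallest_sub; first exact: subgroup_generated.
  move=> x [Ux|xF] K [_]; apply; first by left.
  by right; rewrite /= in_fsetU xF.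
rewrite -(mulVKg h g); apply: (@subgroupM _ (gen (F `|` D)%fset)).
  by apply: gen_mem; rewrite in_fsetU hD orbT.
exact: FFD.
Qed.

End cosets.

Lemma property_FM_compactly_generated (G : topologicalGroupType) :
  locally_compact [set: G] -> property_FM R G -> compactly_generated G.
Proof.
move=> lcG FM; have [K nearK [Kcpt _]] := lcG 1 I.
have K1 : nbhs 1 K by apply: (filterS _ (nearK : nbhs _ _)) => x; exact.
have [F FK] := property_FM_generates K1 FM.
exists (K `|` [set` F]); split=> //; apply: compactU => //.
exact/finite_compact/finite_fset.
Qed.

Lemma property_FM_finitely_generated (G : topologicalGroupType) :
  discrete_group G -> property_FM R G -> finitely_generated G.
Proof.
move=> dG FM.
have nbhs11 : nbhs (1 : G) [set 1] by exact: open_nbhs_nbhs.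
have [F FG] := property_FM_generates nbhs11 FM.
exists ([set 1] `|` [set` F]); split=> //.
by rewrite finite_setU; split; [exact: finite_set1|exact: finite_fset].
Qed.

End generation.

(** * The permanence properties *)

Theorem proposition1p4 (R : realType) :
  ((forall (G : topologicalGroupType) (H : subgroup G),
      locally_compact_group G -> open (H : set G) -> finite_index H ->
      (property_FM R G <-> property_FM R (subgroup_type H))) /\
   (forall (G : topologicalGroupType) (H : subgroup G),
      locally_compact_group G -> closed (H : set G) -> cocompact H ->
      property_FM R (subgroup_type H) -> property_FM R G)) /\
  ((forall (G H : topologicalGroupType) (f : {multiplicative G -> H}),
      locally_compact_group G -> locally_compact_group H ->
      continuous f -> dense (range f) ->
      property_FM R G -> property_FM R H) /\
   (forall (G : topologicalGroupType) (N : normal_subgroup G),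
      locally_compact_group G -> closed (N : set G) ->
      property_FM R G -> property_FM R (quotient_group N))) /\
  (forall (G : topologicalGroupType) (N : normal_subgroup G),
     locally_compact_group G -> closed (N : set G) ->
     property_FM R (subgroup_type N) -> property_FM R (quotient_group N) ->
     property_FM R G) /\
  ((forall G : topologicalGroupType,
      locally_compact_group G -> property_FM R G -> compactly_generated G) /\
   (forall G : topologicalGroupType,
      discrete_group G -> property_FM R G -> finitely_generated G)).
Proof.
split; [split|split; [split|split; [|split]]].
- move=> G H _ Hop fi; split; first exact: property_FM_open_finite_index.
  by apply: property_FM_cocompact; exact: finite_compact.
- by move=> G H _ _; exact: property_FM_cocompact.
- by move=> G H f _ _; exact: property_FM_dense_image.
- by move=> G N _ _; exact: property_FM_quotient.
- by move=> G N _ _; exact: property_FM_extension.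
- by move=> G [_ lcG]; exact: property_FM_compactly_generated.
- by move=> G; exact: property_FM_finitely_generated.
Qed.
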